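(* Suppose the initial inputs to the scalar Kalman filter and to the SPEnKF are identical, i.e. $\tilde x_0=x_0$ and $\tilde p_0=p_0$. Then for every step $i\ge 0$, as the ensemble size tends to infinity ($\alpha=N/2\to\infty$), the expected value and the variance of the discrepancy $\Delta x_i=\hat x^{\mathrm a}_i-x^{\mathrm a}_i$ in the analysis mean tend to zero: $$\lim_{\alpha\to\infty}\mathbb{E}[\Delta x_i]=0,\qquad \lim_{\alpha\to\infty}\left(\mathbb{E}[\Delta x_i^2]-\mathbb{E}[\Delta x_i]^2\right)=0 .$$
   Context: Let $m_0,m_1,\dots$ be nonzero reals, $r>0$, $p_0,\tilde p_0>0$, $x_0,\tilde x_0\in\mathbb{R}$, and let $y_0,y_1,\dots$ be real observations. Scalar Kalman filter: $x^{\mathrm f}_0=x_0$, $p^{\mathrm f}_0=p_0$, and for $i\ge0$: $k_i=\frac{p^{\mathrm f}_i}{p^{\mathrm f}_i+r}$, $x^{\mathrm a}_i=x^{\mathrm f}_i+k_i(y_i-x^{\mathrm f}_i)$, $p^{\mathrm a}_i=(1-k_i)p^{\mathrm f}_i$, $x^{\mathrm f}_{i+1}=m_ix^{\mathrm a}_i$, $p^{\mathrm f}_{i+1}=m_i^2p^{\mathrm a}_i$. SPEnKF (Scalar Pedagogical Ensemble Kalman Filter) with ensemble size $N>1$ and initial inputs $\tilde x_0,\tilde p_0$: $\hat x^{\mathrm f}_0=\tilde x_0$; the initial anomaly vector $\mathbf a^{\mathrm f}_0\in\mathbb{R}^N$ has i.i.d. $\mathcal N(0,\tilde p_0)$ entries;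 and for $i\ge0$: $\hat p^{\mathrm f}_i=\frac1N(\mathbf a^{\mathrm f}_i\cdot\mathbf a^{\mathrm f}_i)$, $\hat k_i=\frac{\hat p^{\mathrm f}_i}{\hat p^{\mathrm f}_i+r}$, $\hat p^{\mathrm a}_i=(1-\hat k_i)\hat p^{\mathrm f}_i$, $\mathbf a^{\mathrm a}_i=(\hat p^{\mathrm a}_i)^{1/2}(\hat p^{\mathrm f}_i)^{-1/2}\mathbf a^{\mathrm f}_i$, $\hat x^{\mathrm a}_i=\hat x^{\mathrm f}_i+\hat k_i(y_i-\hat x^{\mathrm f}_i)$, $\hat x^{\mathrm f}_{i+1}=m_i\hat x^{\mathrm a}_i$, $\mathbf a^{\mathrm f}_{i+1}=m_i\mathbf a^{\mathrm a}_i$. Thus the initial sample variance $\hat p^{\mathrm f}_0$ is distributed as $\Gamma(\alpha,\alpha/\tilde p_0)$ (shape, rate) with $\alpha=N/2$. Expectations are over the random initial anomalies, with the observations held fixed. *)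

(* Defs.v *)
From mathcomp Require Import all_boot all_order all_algebra.
From mathcomp Require Import all_classical all_reals all_analysis.
Import Order.TTheory GRing.Theory Num.Theory.
Import numFieldNormedType.Exports.

Set Implicit Arguments.
Unset Strict Implicit.
Unset Printing Implicit Defensive.

Local Open Scope classical_set_scope.
Local Open Scope ring_scope.

Definition kalman_gain (R : realType) (r p : R) : R := p / (p + r).

Fixpoint kf_pf (R : realType) (m : nat -> R) (r p0 : R) (i : nat) : R :=
  if i is j.+1 then
    let p := kf_pf m r p0 j in m j ^+ 2 * ((1 - kalman_gain r p) * p)
  else p0.

Definition kf_k (R : realType) (m : nat -> R) (r p0 : R) (i : nat) : R :=
  kalman_gain r (kf_pf m r p0 i).

Fixpoint kf_xf (R : realType) (m : nat -> R) (r : R) (y : nat -> R)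
    (x0 p0 : R) (i : nat) : R :=
  if i is j.+1 then
    let x := kf_xf m r y x0 p0 j in m j * (x + kf_k m r p0 j * (y j - x))
  else x0.

Definition kf_xa (R : realType) (m : nat -> R) (r : R) (y : nat -> R)
    (x0 p0 : R) (i : nat) : R :=
  let x := kf_xf m r y x0 p0 i in x + kf_k m r p0 i * (y i - x).

(* The SPEnKF recursion is deterministic once the initial anomaly vector is
   given; randomness enters only through that vector. *)

Definition sample_variance (R : realType) (N : nat) (a : 'rV[R]_N) : R :=
  N%:R^-1 * \sum_(j < N) a 0 j * a 0 j.

(* If the sample variance is zero then a = 0, so the convention 0^-1 = 0 is
   harmless here. *)
Definition analysis_anomalies (R : realType) (r : R) (N : nat) (a : 'rV[R]_N) :
    'rV[R]_N :=
  let pf := sample_variance a in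
  let pa := (1 - kalman_gain r pf) * pf in
  (Num.sqrt pa * (Num.sqrt pf)^-1) *: a.

Fixpoint enkf_af (R : realType) (m : nat -> R) (r : R) (N : nat)
    (a0 : 'rV[R]_N) (i : nat) : 'rV[R]_N :=
  if i is j.+1 then m j *: analysis_anomalies r (enkf_af m r a0 j) else a0.

Definition enkf_k (R : realType) (m : nat -> R) (r : R) (N : nat)
    (a0 : 'rV[R]_N) (i : nat) : R :=
  kalman_gain r (sample_variance (enkf_af m r a0 i)).

Fixpoint enkf_xf (R : realType) (m : nat -> R) (r : R) (y : nat -> R)
    (xt0 : R) (N : nat) (a0 : 'rV[R]_N) (i : nat) : R :=
  if i is j.+1 then
    let x := enkf_xf m r y xt0 a0 j in m j * (x + enkf_k m r a0 j * (y j - x))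
  else xt0.

Definition enkf_xa (R : realType) (m : nat -> R) (r : R) (y : nat -> R)
    (xt0 : R) (N : nat) (a0 : 'rV[R]_N) (i : nat) : R :=
  let x := enkf_xf m r y xt0 a0 i in x + enkf_k m r a0 i * (y i - x).

Definition analysis_discrepancy (R : realType) (m : nat -> R) (r : R)
    (y : nat -> R) (x0 p0 xt0 : R) (N : nat) (a0 : 'rV[R]_N) (i : nat) : R :=
  enkf_xa m r y xt0 a0 i - kf_xa m r y x0 p0 i.

Definition mutually_independent (d : measure_display) (T : measurableType d)
    (R : realType) (P : probability T R) (I : finType)
    (X : I -> {RV P >-> R}) : Prop :=
  forall (J : {set I}) (B : I -> set R),
    (forall j, j \in J -> measurable (B j)) ->
    P (\bigcap_(j in [set` J]) (X j @^-1` B j)) =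
      (\prod_(j in J) P (X j @^-1` B j))%E.

(* The laws are compared on measurable sets only, since a measure is an
   arbitrary set function elsewhere.  [normal_prob] takes the mean and the
   standard deviation. *)
Definition iid_centered_normal (d : measure_display) (T : measurableType d)
    (R : realType) (P : probability T R) (I : finType)
    (X : I -> {RV P >-> R}) (variance : R) : Prop :=
  mutually_independent X /\
  forall (j : I) (B : set R), measurable B ->
    distribution P (X j) B = normal_prob 0 (Num.sqrt variance) B.

(* Main.v *)
(* By induction the SPEnKF is the scalar Kalman filter started from the initial
   sample variance S of the ensemble, so the discrepancy is g(S) - g(p0), where
   g maps an initial variance to the analysis mean.  The gain p / (p + r) is
   bounded and Lipschitz on [0, oo), hence g is Lipschitz there, with some
   constant L, and E[Dx^2] <= L^2 E[(S - p0)^2] = L^2 (E[a^4] - p0^2) / N.  The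
   limits follow, since E[Dx]^2 and Var[Dx] are both at most E[Dx^2].  Only the
   value p0 of the second moment of N(0, p0) and the finiteness of the fourth
   one are needed; both come from comparing Gaussian densities of different
   widths. *)

Require Import Defs.
From HB Require Import structures.
From mathcomp Require Import all_boot all_order all_algebra.
From mathcomp Require Import all_classical all_reals all_analysis.
From mathcomp Require Import measurable_realfun.
From mathcomp Require Import ring lra.
Import Order.TTheory GRing.Theory Num.Theory.
Import numFieldNormedType.Exports.

Set Implicit Arguments.
Unset Strict Implicit.
Unset Printing Implicit Defensive.

Local Open Scope classical_set_scope.
Local Open Scope ring_scope.

(** * The filters as functions of the initial variance *)

Section filters.
Context {R : realType}.
Variables (m : nat -> R) (r : R).
Hypothesis r_gt0 : 0 < r.

Lemma kalman_analysis_varianceE (p : R) : 0 <= p ->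
  (1 - kalman_gain r p) * p = r * p / (p + r).
Proof.
move=> p0; have pr : p + r != 0 by rewrite gt_eqF// ltr_wpDl.
by rewrite /kalman_gain; field.
Qed.

Lemma kalman_analysis_variance_ge0 (p : R) : 0 <= p ->
  0 <= (1 - kalman_gain r p) * p.
Proof.
move=> p0; rewrite kalman_analysis_varianceE//.
by rewrite divr_ge0 ?mulr_ge0 ?addr_ge0// ltW.
Qed.

Lemma kf_pf_ge0 (p : R) i : 0 <= p -> 0 <= kf_pf m r p i.
Proof.
move=> p0; elim: i => //= i IH.
by rewrite mulr_ge0 ?sqr_ge0// kalman_analysis_variance_ge0.
Qed.

Lemma sample_variance_ge0 N (a : 'rV[R]_N) : 0 <= sample_variance a.
Proof.
by rewrite mulr_ge0 ?invr_ge0// sumr_ge0// => j _; rewrite -expr2 sqr_ge0.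
Qed.

Lemma sample_varianceZ N (c : R) (a : 'rV[R]_N) :
  sample_variance (c *: a) = c ^+ 2 * sample_variance a.
Proof.
rewrite /sample_variance mulrCA; congr (_ * _).
by rewrite mulr_sumr; apply: eq_bigr => j _; rewrite mxE; ring.
Qed.

(** The scaling factor of the anomalies squares to the ratio of analysis to forecast variance, so
    the square-root update reproduces the Kalman variance update exactly. With zero variance both
    sides vanish. *)
Lemma sample_variance_analysis N (a : 'rV[R]_N) :
  sample_variance (analysis_anomalies r a) =
  (1 - kalman_gain r (sample_variance a)) * sample_variance a.
Proof.
have s0 := sample_variance_ge0 a.
rewrite sample_varianceZ exprMn exprVn !sqr_sqrtr ?kalman_analysis_variance_ge0//.
have [->|sneq0] := eqVneq (sample_variance a) 0; first by rewrite !mulr0.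
by rewrite divfK.
Qed.

Lemma sample_variance_enkf N (a : 'rV[R]_N) i :
  sample_variance (enkf_af m r a i) = kf_pf m r (sample_variance a) i.
Proof.
elim: i => //= i IH.
by rewrite sample_varianceZ sample_variance_analysis IH.
Qed.

Lemma enkf_kE N (a : 'rV[R]_N) i :
  enkf_k m r a i = kf_k m r (sample_variance a) i.
Proof. by rewrite /enkf_k /kf_k sample_variance_enkf. Qed.

Lemma enkf_xfE (y : nat -> R) (x : R) N (a : 'rV[R]_N) i :
  enkf_xf m r y x a i = kf_xf m r y x (sample_variance a) i.
Proof. by elim: i => //= i IH; rewrite enkf_kE IH. Qed.

Lemma enkf_xaE (y : nat -> R) (x : R) N (a : 'rV[R]_N) i :
  enkf_xa m r y x a i = kf_xa m r y x (sample_variance a) i.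
Proof. by rewrite /enkf_xa /kf_xa enkf_kE enkf_xfE. Qed.

(** * Lipschitz dependence of the Kalman filter on its initial variance *)

Definition lipschitz_nneg (f : R -> R) :=
  exists L, forall s t, 0 <= s -> 0 <= t -> `|f s - f t| <= L * `|s - t|.

Definition bounded_nneg (f : R -> R) :=
  exists B, forall s, 0 <= s -> `|f s| <= B.

Lemma lipschitz_nneg_cst c : lipschitz_nneg (fun=> c).
Proof. by exists 0 => s t _ _; rewrite subrr normr0 mul0r. Qed.

Lemma bounded_nneg_cst c : bounded_nneg (fun=> c).
Proof. by exists `|c|. Qed.

Lemma lipschitz_nnegD (f g : R -> R) : lipschitz_nneg f -> lipschitz_nneg g ->
  lipschitz_nneg (fun s => f s + g s).
Proof.
move=> [L hf] [M hg]; exists (L + M) => s t s0 t0.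
rewrite opprD addrACA (le_trans (ler_normD _ _))// mulrDl.
by rewrite lerD ?hf ?hg.
Qed.

Lemma bounded_nnegD (f g : R -> R) : bounded_nneg f -> bounded_nneg g ->
  bounded_nneg (fun s => f s + g s).
Proof.
move=> [L hf] [M hg]; exists (L + M) => s s0.
by rewrite (le_trans (ler_normD _ _))// lerD ?hf ?hg.
Qed.

Lemma bounded_nnegM (f g : R -> R) : bounded_nneg f -> bounded_nneg g ->
  bounded_nneg (fun s => f s * g s).
Proof.
move=> [L hf] [M hg]; exists (L * M) => s s0.
by rewrite normrM ler_pM ?hf ?hg.
Qed.

(** Changing one factor at a time leaves the other as a coefficient. This is why boundedness is
    tracked along with the Lipschitz property. *)
Lemma lipschitz_nnegM (f g : R -> R) :
  bounded_nneg f -> bounded_nneg g ->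
  lipschitz_nneg f -> lipschitz_nneg g ->
  lipschitz_nneg (fun s => f s * g s).
Proof.
move=> [B hB] [C hC] [L hf] [M hg]; exists (B * M + C * L) => s t s0 t0.
have -> : f s * g s - f t * g t = f s * (g s - g t) + g t * (f s - f t) by ring.
rewrite (le_trans (ler_normD _ _))// !normrM mulrDl -!mulrA.
by rewrite lerD// ler_pM ?hB ?hC ?hf ?hg.
Qed.

Lemma kalman_gain_le1 (p : R) : 0 <= p -> `|kalman_gain r p| <= 1.
Proof.
move=> p0; have pr : 0 < p + r by rewrite ltr_wpDl.
by rewrite ger0_norm ?divr_ge0 ?(ltW pr)// ler_pdivrMr// mul1r lerDl ltW.
Qed.

(** The difference quotient is r / ((p + r) (q + r)), and both factors of the denominator are at
    least r; hence the constant 1 / r. *)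
Lemma kalman_gain_lipschitz : lipschitz_nneg (kalman_gain r).
Proof.
exists r^-1 => p q p0 q0.
have pr : 0 < p + r by rewrite ltr_wpDl.
have qr : 0 < q + r by rewrite ltr_wpDl.
have -> : kalman_gain r p - kalman_gain r q =
    r / ((p + r) * (q + r)) * (p - q).
  by rewrite /kalman_gain; field; rewrite !gt_eqF.
rewrite normrM ler_wpM2r// ger0_norm; last first.
  by rewrite divr_ge0 ?(ltW r_gt0)// mulr_ge0 ?ltW.
rewrite ler_pdivrMr ?mulr_gt0// ler_pdivlMl//.
have := mulr_ge0 p0 q0; have := mulr_ge0 p0 (ltW r_gt0).
by have := mulr_ge0 q0 (ltW r_gt0); lra.
Qed.

(** The identity at step 0 is unbounded, so [lipschitz_nnegM] does not apply. Instead, p -> r p / (p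
    + r) is nonexpansive: its difference quotient r^2 / ((p + r) (q + r)) is at most 1. Each step
    thus multiplies the constant by [m i ^+ 2] only. *)
Lemma kf_pf_lipschitz i : lipschitz_nneg (fun p => kf_pf m r p i).
Proof.
elim: i => [|i [L IH]] /=; first by exists 1 => s t _ _; rewrite mul1r.
exists (m i ^+ 2 * L) => s t s0 t0.
have := IH _ _ s0 t0.
have := kf_pf_ge0 i s0; have := kf_pf_ge0 i t0.
move: (kf_pf m r s i) (kf_pf m r t i) => p q q0 p0 pq.
rewrite !kalman_analysis_varianceE// -mulrBr normrM ger0_norm ?sqr_ge0//.
rewrite -(mulrA (m i ^+ 2)) ler_wpM2l ?sqr_ge0// (le_trans _ pq)//.
have pr : 0 < p + r by rewrite ltr_wpDl.
have qr : 0 < q + r by rewrite ltr_wpDl.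
have -> : r * p / (p + r) - r * q / (q + r) =
    r ^+ 2 / ((p + r) * (q + r)) * (p - q).
  by field; rewrite !gt_eqF.
rewrite normrM ler_piMl// ger0_norm; last first.
  by rewrite divr_ge0 ?sqr_ge0// mulr_ge0 ?ltW.
rewrite ler_pdivrMr ?mulr_gt0// mul1r.
have := mulr_ge0 p0 q0; have := mulr_ge0 p0 (ltW r_gt0).
by have := mulr_ge0 q0 (ltW r_gt0); lra.
Qed.

Lemma kf_k_lipschitz i : lipschitz_nneg (fun p => kf_k m r p i).
Proof.
have [L hL] := kf_pf_lipschitz i; have [M hM] := kalman_gain_lipschitz.
(* The definition records no sign for [M]; its absolute value may safely multiply an inequality. *)
exists (`|M| * L) => s t s0 t0; rewrite -mulrA.
apply: (le_trans (hM _ _ (kf_pf_ge0 i s0) (kf_pf_ge0 i t0))).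
apply: (le_trans (ler_wpM2r (normr_ge0 _) (ler_norm M))).
by rewrite ler_wpM2l ?hL.
Qed.

Lemma kf_k_bounded i : bounded_nneg (fun p => kf_k m r p i).
Proof. by exists 1 => s s0; rewrite kalman_gain_le1// kf_pf_ge0. Qed.

(** The correction k (y - x) is a product of two functions of the initial variance, so both
    properties of the forecast mean are used together. This serves as the induction step for the
    forecast mean and as the final passage to the analysis mean. *)
Lemma kf_xa_bounded_lipschitz_of_xf (y : nat -> R) (x : R) i :
  bounded_nneg (fun p => kf_xf m r y x p i) /\
    lipschitz_nneg (fun p => kf_xf m r y x p i) ->
  bounded_nneg (fun p => kf_xa m r y x p i) /\
    lipschitz_nneg (fun p => kf_xa m r y x p i).
Proof.
move=> [bx lx].
have bi : bounded_nneg (fun p => y i - kf_xf m r y x p i).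
  have [B hB] := bx; exists (`|y i| + B) => s s0.
  by rewrite (le_trans (ler_normB _ _))// lerD2l hB.
have li : lipschitz_nneg (fun p => y i - kf_xf m r y x p i).
  have [L hL] := lx; exists L => s t s0 t0.
  by rewrite opprB addrC addrA subrK distrC hL.
have bk := kf_k_bounded i; have lk := kf_k_lipschitz i.
split; first exact: bounded_nnegD bx (bounded_nnegM bk bi).
exact: lipschitz_nnegD lx (lipschitz_nnegM bk bi lk li).
Qed.

Lemma kf_xf_bounded_lipschitz (y : nat -> R) (x : R) i :
  bounded_nneg (fun p => kf_xf m r y x p i) /\
  lipschitz_nneg (fun p => kf_xf m r y x p i).
Proof.
elim: i => [|i IH] /=.
  by split; [exact: bounded_nneg_cst|exact: lipschitz_nneg_cst].
have [ba la] := kf_xa_bounded_lipschitz_of_xf IH.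
have bm := bounded_nneg_cst (m i); have lm := lipschitz_nneg_cst (m i).
by split; [exact: bounded_nnegM bm ba|exact: lipschitz_nnegM bm ba lm la].
Qed.

Lemma kf_xa_lipschitz (y : nat -> R) (x : R) i :
  lipschitz_nneg (fun p => kf_xa m r y x p i).
Proof.
exact: (kf_xa_bounded_lipschitz_of_xf (kf_xf_bounded_lipschitz y x i)).2.
Qed.

End filters.

(** * Moments of the normal law *)

Section normal_moments.
Context {R : realType}.
Local Notation mu := (@lebesgue_measure R).
Implicit Types (s t x : R).

Lemma ge0_integral_normal_prob (m s : R) (f : R -> \bar R) :
  measurable_fun [set: R] f -> (forall x, 0 <= f x)%E ->
  (\int[normal_prob m s]_x f x = \int[mu]_x (f x * (normal_pdf m s x)%:E))%E.
Proof.
move=> mf f0; have dom := @normal_prob_dominates R m s.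
rewrite -(Radon_Nikodym_SigmaFinite.change_of_variables dom)//.
have intRN := Radon_Nikodym_SigmaFinite.f_integrable dom.
have mpdf : measurable_fun [set: R] (fun x => (normal_pdf m s x)%:E).
  by apply/measurable_EFinP; exact: measurable_normal_pdf.
apply: ae_eq_integral => //.
- exact: emeasurable_funM (measurable_int mu intRN).
- exact: emeasurable_funM.
(* The Radon-Nikodym derivative and the normal density have the same integral over every measurable
   set, so they agree almost everywhere. *)
- apply: ae_eqe_mul2l; apply: integral_ae_eq => // E _ mE.
  by rewrite -Radon_Nikodym_SigmaFinite.f_integral.
Qed.

(** Coefficient of x^2 in the exponent when the centered Gaussian of standard deviation t is divided
    by that of standard deviation s; positive for s < t, negative for t < s. *)
Definition gauss_rate s t : R := (s ^- 2 - t ^- 2) / 2.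

Lemma normal_peakE s : 0 < s -> normal_peak s = (s * Num.sqrt (pi *+ 2))^-1.
Proof.
move=> s0; rewrite /normal_peak -mulrnAr sqrtrM ?sqr_ge0// sqrtr_sqr.
by rewrite gtr0_norm.
Qed.

Lemma normal_pdf_change_sd s t x : 0 < s -> 0 < t ->
  normal_pdf 0 s x * expR (gauss_rate s t * x ^+ 2) = t / s * normal_pdf 0 t x.
Proof.
move=> s0 t0; rewrite !normal_pdfE ?gt_eqF// !normal_peakE//.
have q0 : Num.sqrt (pi *+ 2) != 0 :> R.
  by rewrite gt_eqF// sqrtr_gt0 mulrn_wgt0// pi_gt0.
have -> : normal_fun 0 t x =
    normal_fun 0 s x * expR (gauss_rate s t * x ^+ 2).
  rewrite /normal_fun -expRD; congr expR.
  by rewrite /gauss_rate; field; rewrite !gt_eqF.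
by field; rewrite q0 !gt_eqF.
Qed.

(* [1 + u <= expR u] with [u = gauss_rate s t * x ^+ 2], of either sign *)
Lemma normal_pdf_sqr_le s t x : 0 < s -> 0 < t ->
  normal_pdf 0 s x + gauss_rate s t * (x ^+ 2 * normal_pdf 0 s x) <=
  t / s * normal_pdf 0 t x.
Proof.
move=> s0 t0; rewrite -normal_pdf_change_sd//.
rewrite [leLHS](_ : _ = normal_pdf 0 s x * (1 + gauss_rate s t * x ^+ 2)).
  by rewrite ler_wpM2l ?normal_pdf_ge0// expR_ge1Dx.
by ring.
Qed.

(** Put u = h x^2 / 2. Then h^2 x^4 = 4 u^2 and u <= exp u, so x^4 <= (4 / h^2) exp (h x^2). This
    exponential turns the density of width s into twice that of width 2 s, hence the 8. *)
Lemma normal_pdf_pow4_le s x : 0 < s ->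
  x ^+ 4 * normal_pdf 0 s x <=
  8 / gauss_rate s (2 * s) ^+ 2 * normal_pdf 0 (2 * s) x.
Proof.
move=> s0; have t0 : 0 < 2 * s by rewrite mulr_gt0.
set h := gauss_rate s (2 * s).
have h0 : 0 < h.
  rewrite /h /gauss_rate [ltRHS](_ : _ = 3 / 8 * s ^- 2).
    by rewrite mulr_gt0 ?invr_gt0 ?exprn_gt0// divr_gt0.
  by field; rewrite gt_eqF.
have := normal_pdf_change_sd x s0 t0; rewrite -/h mulfK ?gt_eqF// => e.
rewrite [leRHS](_ : _ = 4 / h ^+ 2 * (2 * normal_pdf 0 (2 * s) x)); last first.
  by field; rewrite gt_eqF.
rewrite -e mulrCA [leLHS]mulrC ler_wpM2l ?normal_pdf_ge0//.
rewrite mulrAC ler_pdivlMr ?exprn_gt0//.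
have u0 : 0 <= h * x ^+ 2 / 2 by rewrite divr_ge0// mulr_ge0 ?sqr_ge0 ?ltW.
have -> : h * x ^+ 2 = h * x ^+ 2 / 2 + h * x ^+ 2 / 2 by field.
rewrite expRD.
have : h * x ^+ 2 / 2 <= expR (h * x ^+ 2 / 2).
  by rewrite (le_trans _ (expR_ge1Dx _))// lerDr.
set u := h * x ^+ 2 / 2 => uE.
have -> : x ^+ 4 * h ^+ 2 = 4 * (u * u) by rewrite /u; field.
by rewrite ler_wpM2l// ler_pM.
Qed.

Let measurable_xpow n : measurable_fun [set: R] (fun x => (x ^+ n)%:E).
Proof. by apply/measurable_EFinP; exact: measurable_funX. Qed.

Let measurable_xpow_pdf n s :
  measurable_fun [set: R] (fun x => (x ^+ n * normal_pdf 0 s x)%:E).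
Proof.
apply/measurable_EFinP/measurable_funM; last exact: measurable_normal_pdf.
exact: measurable_funX.
Qed.

Let integral_pdfZ (c s : R) : 0 <= c ->
  (\int[mu]_x (c * normal_pdf 0 s x)%:E = c%:E)%E.
Proof.
move=> c0; under eq_integral do rewrite EFinM.
rewrite ge0_integralZl_EFin//; first by rewrite integral_normal_pdf mule1.
- by move=> x _; rewrite lee_fin normal_pdf_ge0.
- by apply/measurable_EFinP; exact: measurable_normal_pdf.
Qed.

Lemma normal_fourth_moment_fin s : 0 < s ->
  exists M, (\int[normal_prob 0 s]_x (x ^+ 4)%:E = M%:E)%E.
Proof.
move=> s0; set I := (\int[_]_x _)%E.
have I0 : (0 <= I)%E by apply: integral_ge0 => x _; rewrite lee_fin exprn_even_ge0.
have : (I <= (8 / gauss_rate s (2 * s) ^+ 2)%:E)%E.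
  rewrite /I ge0_integral_normal_prob//; last first.
    by move=> x; rewrite lee_fin exprn_even_ge0.
  rewrite -(@integral_pdfZ _ (2 * s)) ?divr_ge0 ?sqr_ge0//.
  under eq_integral do rewrite -EFinM.
  apply: ge0_le_integral => //.
  - by move=> x _; rewrite lee_fin mulr_ge0 ?normal_pdf_ge0 ?exprn_even_ge0.
  - apply/measurable_EFinP/measurable_funM => //.
    exact: measurable_normal_pdf.
  - apply/measurable_EFinP/measurable_funM => //.
    exact: measurable_normal_pdf.
  - by move=> x _; rewrite lee_fin normal_pdf_pow4_le.
by clearbody I; case: I I0 => //= M _ _; exists M.
Qed.

(* Integrating [normal_pdf_sqr_le] gives 1 + gauss_rate s t * I <= t / s for the
   second moment I; this forces I <= t ^+ 2 for every t > s, and t ^+ 2 <= I for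
   every t < s. *)
Lemma normal_second_moment s : 0 < s ->
  (\int[normal_prob 0 s]_x (x ^+ 2)%:E = (s ^+ 2)%:E)%E.
Proof.
move=> s0.
rewrite ge0_integral_normal_prob//; last by move=> x; rewrite lee_fin sqr_ge0.
under eq_integral do rewrite -EFinM.
set I := (\int[_]_x _)%E.
have q0 x : 0 <= x ^+ 2 * normal_pdf 0 s x.
  by rewrite mulr_ge0 ?normal_pdf_ge0 ?sqr_ge0.
have I0 : (0 <= I)%E by apply: integral_ge0 => x _; rewrite lee_fin.
have mpdf t : measurable_fun [set: R] (fun x => (normal_pdf 0 t x)%:E).
  by apply/measurable_EFinP; exact: measurable_normal_pdf.
have mZ c t : measurable_fun [set: R] (fun x => (c * normal_pdf 0 t x)%:E).
  by apply/measurable_EFinP/measurable_funM => //; exact: measurable_normal_pdf.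
have mq c : measurable_fun [set: R] (fun x => (c * (x ^+ 2 * normal_pdf 0 s x))%:E).
  apply/measurable_EFinP/measurable_funM => //.
  by apply/measurable_EFinP; exact: measurable_xpow_pdf.
have Iq c : 0 <= c ->
    (\int[mu]_x (c * (x ^+ 2 * normal_pdf 0 s x))%:E = c%:E * I)%E.
  move=> c0; under eq_integral do rewrite EFinM.
  rewrite ge0_integralZl_EFin//; last exact: measurable_xpow_pdf.
  by move=> x _; rewrite lee_fin.
(* For s < t the rate is nonnegative, so the integrals of nonnegative functions add up even if [I]
   is infinite. *)
have up t : s < t -> (1 + (gauss_rate s t)%:E * I <= (t / s)%:E)%E.
  move=> st; have t0 := lt_trans s0 st.
  have ts0 : 0 <= t / s by rewrite divr_ge0 ?ltW.
  have h0 : 0 <= gauss_rate s t.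
    rewrite divr_ge0// subr_ge0 lef_pV2 ?posrE ?exprn_gt0//.
    by rewrite ler_sqr ?nnegrE ?ltW.
  rewrite -(integral_normal_pdf 0 s) -Iq// -(@integral_pdfZ (t / s) t)//.
  rewrite -ge0_integralD//; first last.
  - exact: mq.
  - by move=> x _; rewrite lee_fin mulr_ge0.
  - exact: mpdf.
  - by move=> x _; rewrite lee_fin normal_pdf_ge0.
  apply: ge0_le_integral => //.
  - by move=> x _; rewrite -EFinD lee_fin addr_ge0 ?normal_pdf_ge0// mulr_ge0.
  - exact: emeasurable_funD (mpdf s) (mq _).
  - exact: mZ.
  - by move=> x _; rewrite -EFinD lee_fin normal_pdf_sqr_le.
(* For t < s the rate is negative; its term moves to the right so that every integrand stays
   nonnegative. *)
have lo t : 0 < t -> t < s -> (1 <= (t / s)%:E + (- gauss_rate s t)%:E * I)%E.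
  move=> t0 st.
  have ts0 : 0 <= t / s by rewrite divr_ge0 ?ltW.
  have h0 : 0 <= - gauss_rate s t.
    rewrite -mulNr opprB divr_ge0// subr_ge0 lef_pV2 ?posrE ?exprn_gt0//.
    by rewrite ler_sqr ?nnegrE ?ltW.
  rewrite -[leLHS](integral_normal_pdf 0 s) -Iq// -(@integral_pdfZ (t / s) t)//.
  rewrite -ge0_integralD//; first last.
  - exact: mq.
  - by move=> x _; rewrite lee_fin mulr_ge0.
  - exact: mZ.
  - by move=> x _; rewrite lee_fin mulr_ge0 ?normal_pdf_ge0.
  apply: ge0_le_integral => //.
  - by move=> x _; rewrite lee_fin normal_pdf_ge0.
  - exact: mpdf.
  - exact: emeasurable_funD (mZ _ t) (mq _).
  - move=> x _; rewrite -EFinD lee_fin.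
    by rewrite mulNr lerBrDr normal_pdf_sqr_le.
have rateM t : 0 < t -> gauss_rate s t * (2 * s ^+ 2 * t ^+ 2) = (t - s) * (t + s).
  by move=> t0; rewrite /gauss_rate; field; rewrite !gt_eqF.
clearbody I; clear Iq; case: I up lo I0 => [M up lo|up _ _|//]; last first.
  (* Case of an infinite [I]: at t = 2 s the rate is positive, so [up] would bound infinity by a
     real number. *)
  have s2 : s < 2 * s by rewrite ltr_pMl// ltr1n.
  have := up _ s2; rewrite gt0_muley//.
  rewrite lte_fin -(pmulr_lgt0 _ (_ : 0 < 2 * s ^+ 2 * (2 * s) ^+ 2)).
    by rewrite rateM ?mulr_gt0 ?subr_gt0 ?addr_gt0 ?mulr_gt0.
  by rewrite !mulr_gt0 ?exprn_gt0 ?mulr_gt0.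
rewrite lee_fin => M0; congr (_%:E); apply/eqP; rewrite eq_le; apply/andP; split.
- rewrite leNgt; apply/negP => sM.
  have M1 : 0 < M by rewrite (lt_trans _ sM)// exprn_gt0.
  have sq : s < Num.sqrt M.
    by rewrite -(ltr_sqr) ?nnegrE ?sqrtr_ge0 ?(ltW s0)// sqr_sqrtr.
  (* Any t strictly between s and the square root of M contradicts [up]. *)
  pose t := (s + Num.sqrt M) / 2.
  have st : s < t by rewrite /t; lra.
  have tM : t < Num.sqrt M by rewrite /t; lra.
  clearbody t.
  have t0 := lt_trans s0 st.
  have tM2 : t ^+ 2 < M.
    by rewrite -[ltRHS]sqr_sqrtr ?(ltW M1)// ltr_sqr ?nnegrE ?sqrtr_ge0// ltW.
  have := up _ st; rewrite -EFinM -EFinD lee_fin ler_pdivlMr//.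
  rewrite leNgt => /negP; apply.
  (* This factor clears all denominators; the difference of the two sides then splits into t - s and
     a positive cofactor. *)
  rewrite -(ltr_pM2r (_ : 0 < 2 * s * t ^+ 2)) ?mulr_gt0 ?exprn_gt0//.
  have -> : (1 + gauss_rate s t * M) * s * (2 * s * t ^+ 2) =
      2 * s ^+ 2 * t ^+ 2 + M * ((t - s) * (t + s)).
    by rewrite -rateM//; ring.
  rewrite -subr_gt0.
  have -> : 2 * s ^+ 2 * t ^+ 2 + M * ((t - s) * (t + s)) - t * (2 * s * t ^+ 2)
     = (t - s) * ((t + s) * (M - t ^+ 2) + t ^+ 2 * (t - s)) by ring.
  by rewrite mulr_gt0 ?subr_gt0// addr_gt0// mulr_gt0 ?subr_gt0 ?addr_gt0 ?exprn_gt0.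
- rewrite leNgt; apply/negP => sM.
  have sq : Num.sqrt M < s.
    by rewrite -(ltr_sqr) ?nnegrE ?sqrtr_ge0 ?(ltW s0)// sqr_sqrtr.
  have q1 := sqrtr_ge0 M.
  (* The mirror image: t lies between the square root of M and s, and contradicts [lo]. *)
  pose t := (s + Num.sqrt M) / 2.
  have st : t < s by rewrite /t; lra.
  have tM : Num.sqrt M < t by rewrite /t; lra.
  clearbody t.
  have t0 := le_lt_trans q1 tM.
  have tM2 : M < t ^+ 2.
    by rewrite -[ltLHS]sqr_sqrtr ?(ltW t0)// ltr_sqr ?nnegrE// ltW.
  have := lo _ t0 st; rewrite -EFinM -EFinD lee_fin mulNr lerBrDr ler_pdivlMr//.
  rewrite leNgt => /negP; apply.
  rewrite -(ltr_pM2r (_ : 0 < 2 * s * t ^+ 2)) ?mulr_gt0 ?exprn_gt0//.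
  have -> : (1 + gauss_rate s t * M) * s * (2 * s * t ^+ 2) =
      2 * s ^+ 2 * t ^+ 2 + M * ((t - s) * (t + s)).
    by rewrite -rateM//; ring.
  rewrite -subr_gt0.
  have -> : 2 * s ^+ 2 * t ^+ 2 + M * ((t - s) * (t + s)) - t * (2 * s * t ^+ 2)
     = (s - t) * ((t + s) * (t ^+ 2 - M) + t ^+ 2 * (s - t)) by ring.
  by rewrite mulr_gt0 ?subr_gt0// addr_gt0// mulr_gt0 ?subr_gt0 ?addr_gt0 ?exprn_gt0.
Qed.

End normal_moments.

(** * Weak law of large numbers for the sample variance *)

Section independence.
Local Open Scope ereal_scope.
Context d (T : measurableType d) (R : realType) (P : probability T R).
Context (I : finType) (X : I -> {RV P >-> R}).
Hypothesis Xindep : mutually_independent X.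

Lemma mutually_independent_pair j k (A B : set R) : j != k ->
  measurable A -> measurable B ->
  P (X j @^-1` A `&` X k @^-1` B) = P (X j @^-1` A) * P (X k @^-1` B).
Proof.
move=> jk mA mB.
pose C i := if i == j then A else B.
have := @Xindep [set j; k]%SET C.
rewrite big_setU1/= ?inE// big_set1/=.
have Ck : C k = B by rewrite /C eq_sym (negbTE jk).
have Cj : C j = A by rewrite /C eqxx.
rewrite Cj Ck => <-; last by move=> i _; rewrite /C; case: ifP.
congr (P _); apply/seteqP; split => w /=.
  by move=> [Aw Bw] i /=; rewrite !inE => /orP[] /eqP ->; rewrite ?Cj ?Ck.
by move=> H; split; [rewrite -Cj|rewrite -Ck]; apply: H => /=; rewrite !inE eqxx ?orbT.
Qed.

(** By independence the joint law agrees with the product of the marginals on rectangles, hence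
    everywhere; Tonelli then separates the integrals. *)
Lemma mutually_independent_integralM (j k : I) (f g : R -> \bar R) : j != k ->
  measurable_fun [set: R] f -> measurable_fun [set: R] g ->
  (forall x, 0 <= f x) -> (forall x, 0 <= g x) ->
  \int[P]_w (f (X j w) * g (X k w)) =
  (\int[P]_w f (X j w)) * (\int[P]_w g (X k w)).
Proof.
move=> jk mf mg f0 g0.
have mXY : measurable_fun [set: T] (fun w => (X j w, X k w)).
  exact: measurable_fun_pair.
pose XY : {mfun T >-> (R * R)%type} := HB.pack (fun w => (X j w, X k w))
  (isMeasurableFun.Build _ _ _ _ _ mXY).
pose h (z : R * R) := f z.1 * g z.2.
have mh : measurable_fun setT h.
  by apply: emeasurable_funM; [exact: measurableT_comp|exact: measurableT_comp].
have h0 z : 0 <= h z by rewrite mule_ge0.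
transitivity (\int[distribution P XY]_z h z).
  by rewrite ge0_integral_distribution.
rewrite (eq_measure_integral (distribution P (X j) \x distribution P (X k))%E); last first.
  move=> A mA _; apply/esym; apply: product_measure_unique => // B C mB mC.
  by rewrite -mutually_independent_pair.
rewrite fubini_tonelli1//= /fubini_F /h/=.
under eq_integral do rewrite ge0_integralZl//.
rewrite ge0_integralZr//; last by apply: integral_ge0.
by rewrite !ge0_integral_distribution.
Qed.

End independence.

(** * Mean square deviation of an average of uncorrelated nonnegative variables *)

Section mean_square_deviation.
Local Open Scope ereal_scope.
Context d (T : measurableType d) (R : realType) (P : probability T R).
Variables (N : nat) (Z : 'I_N -> T -> R) (p M : R).
Hypothesis N_gt0 : (0 < N)%N.
Hypothesis mZ : forall j, measurable_fun [set: T] (Z j).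
Hypothesis Z_ge0 : forall j w, (0 <= Z j w)%R.
Hypothesis EZ : forall j, \int[P]_w (Z j w)%:E = p%:E.
Hypothesis EZ2 : forall j, \int[P]_w (Z j w * Z j w)%:E = M%:E.
Hypothesis EZZ : forall j k, j != k -> \int[P]_w (Z j w * Z k w)%:E = (p ^+ 2)%:E.

Let S w := (N%:R^-1 * \sum_(j < N) Z j w)%R.

Let NV_ge0 : (0 <= N%:R^-1 :> R)%R. Proof. by rewrite invr_ge0. Qed.
Let N_neq0 : N%:R != 0%R :> R. Proof. by rewrite pnatr_eq0 -lt0n. Qed.

Let S_ge0 w : (0 <= S w)%R.
Proof. by rewrite mulr_ge0// sumr_ge0. Qed.

Let mS : measurable_fun [set: T] S.
Proof. by apply: measurable_funM => //; exact: measurable_sum. Qed.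

Let integral_mean : \int[P]_w (S w)%:E = p%:E.
Proof.
rewrite /S; under eq_integral do rewrite EFinM -sumEFin.
rewrite ge0_integralZl_EFin//; first last.
- by apply: emeasurable_sum => j; exact/measurable_EFinP.
- by move=> w _; apply: sume_ge0 => j _; rewrite lee_fin.
rewrite ge0_integral_sum//; first last.
- by move=> j w _; rewrite lee_fin.
- by move=> j; exact/measurable_EFinP.
under eq_bigr do rewrite EZ.
by rewrite sumEFin -EFinM sumr_const card_ord -[(p *+ N)%R]mulr_natl mulKf.
Qed.

Let integral_mean_sqr :
  \int[P]_w (S w ^+ 2)%:E = (p ^+ 2 + (M - p ^+ 2) / N%:R)%:E.
Proof.
have SE w : ((S w ^+ 2)%:E = (N%:R^-1 ^+ 2)%:E *
    \sum_(j < N) \sum_(k < N) (Z j w * Z k w)%:E)%E.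
  rewrite /S exprMn EFinM; congr (_ * _).
  under [RHS]eq_bigr do rewrite sumEFin.
  rewrite sumEFin expr2 mulr_suml; congr (_%:E).
  by apply: eq_bigr => j _; rewrite mulr_sumr.
have mZZ j k : measurable_fun [set: T] (fun w => (Z j w * Z k w)%:E).
  by apply/measurable_EFinP; exact: measurable_funM.
under eq_integral do rewrite SE.
rewrite ge0_integralZl_EFin ?sqr_ge0//; first last.
- by apply: emeasurable_sum => j; exact: emeasurable_sum.
- move=> w _; apply: sume_ge0 => j _; apply: sume_ge0 => k _.
  by rewrite lee_fin mulr_ge0.
rewrite ge0_integral_sum//; first last.
- by move=> j w _; apply: sume_ge0 => k _; rewrite lee_fin mulr_ge0.
- by move=> j; exact: emeasurable_sum.
have EZj j : \int[P]_w (\sum_(k < N) (Z j w * Z k w)%:E) =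
    (N%:R * p ^+ 2 + (M - p ^+ 2))%:E.
  rewrite ge0_integral_sum//; last by move=> k w _; rewrite lee_fin mulr_ge0.
  (* Every entry of row j counts as p^2, and the diagonal one is corrected by M - p^2. *)
  rewrite (eq_bigr (fun k => (p ^+ 2 + (if k == j then M - p ^+ 2 else 0))%:E)).
    rewrite sumEFin big_split/= sumr_const card_ord -big_mkcond/= big_pred1_eq.
    by rewrite mulr_natl.
  move=> k _; have [->|kj] := eqVneq k j; first by rewrite EZ2 addrC subrK.
  by rewrite EZZ 1?eq_sym// addr0.
under eq_bigr do rewrite EZj.
rewrite sumEFin -EFinM sumr_const card_ord; congr (_%:E).
by rewrite -mulr_natl; field.
Qed.

(* Expanding the square as (S - p)^2 + 2 p S = S^2 + p^2 keeps every integrand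
   nonnegative, so that no integrability has to be checked. *)
Lemma integral_mean_deviation_sqr :
  \int[P]_w ((N%:R^-1 * (\sum_(j < N) Z j w) - p) ^+ 2)%:E =
  ((M - p ^+ 2) / N%:R)%:E.
Proof.
have p0 : (0 <= p)%R.
  by rewrite -lee_fin -integral_mean; apply: integral_ge0 => w _; rewrite lee_fin.
have mD : measurable_fun [set: T] (fun w => ((S w - p) ^+ 2)%:E).
  by apply/measurable_EFinP; apply: measurable_funX; exact: measurable_funB.
have mpS : measurable_fun [set: T] (fun w => (2 * p * S w)%:E).
  by apply/measurable_EFinP; exact: measurable_funM.
have mSS : measurable_fun [set: T] (fun w => (S w ^+ 2)%:E).
  by apply/measurable_EFinP; exact: measurable_funX.
have p20 : (0 <= 2 * p)%R by rewrite mulr_ge0.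
have : \int[P]_w (((S w - p) ^+ 2)%:E + (2 * p * S w)%:E) =
       \int[P]_w ((S w ^+ 2)%:E + (p ^+ 2)%:E).
  by apply: eq_integral => w _; rewrite -!EFinD; congr (_%:E); ring.
rewrite ge0_integralD//; first last.
- by move=> w _; rewrite lee_fin mulr_ge0.
- by move=> w _; rewrite lee_fin sqr_ge0.
rewrite ge0_integralD//; first last.
- by move=> w _; rewrite lee_fin sqr_ge0.
- by move=> w _; rewrite lee_fin sqr_ge0.
under [in X in _ + X]eq_integral do rewrite EFinM.
rewrite ge0_integralZl_EFin//; first last.
- exact/measurable_EFinP.
- by move=> w _; rewrite lee_fin.
rewrite integral_mean integral_mean_sqr integral_cst//= probability_setT mule1.
rewrite -EFinM -EFinD -/(S _).
(* The other terms of the identity are finite, so [I] is finite too and can be solved for. *)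
set I := \int[P]_w _.
rewrite -/I; case: I => // x; rewrite -EFinD => -[e]; congr (_%:E).
by move: e; move: (_ / _)%R => z e; lra.
Qed.

End mean_square_deviation.

Section sample_variance_deviation.
Local Open Scope ereal_scope.
Context d (T : measurableType d) (R : realType) (P : probability T R).
Context (N : nat) (X : 'I_N -> {RV P >-> R}) (p M : R).
Hypothesis N_gt0 : (0 < N)%N.
Hypothesis p_gt0 : (0 < p)%R.
Hypothesis iidX : iid_centered_normal X p.
Hypothesis M4 : \int[normal_prob 0 (Num.sqrt p)]_x (x ^+ 4)%:E = M%:E.

(* [R] carries the Borel sets under two distinct displays: that of the random
   variables and that of [normal_prob]. *)
Lemma iid_centered_normal_integral (f : R -> \bar R) j :
  measurable_fun [set: R] f -> (forall x, 0 <= f x) ->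
  \int[P]_w f (X j w) = \int[normal_prob 0 (Num.sqrt p)]_x f x.
Proof.
move=> mf f0.
have mX : measurable_fun [set: T] (X j : T -> measurableTypeR R).
  exact: (measurable_funPT (X j)).
pose Xj : {mfun T >-> measurableTypeR R} := HB.pack (X j : T -> measurableTypeR R)
  (isMeasurableFun.Build _ _ _ _ _ mX).
rewrite -(ge0_integral_distribution Xj)//.
by apply: eq_measure_integral => A mA _; exact: (iidX.2 j A mA).
Qed.

(** The average is taken over the squared anomalies: their mean is p, their second moment is the
    Gaussian fourth moment M, and independence makes the mixed moments p^2. *)
Lemma sample_variance_deviation_sqr :
  \int[P]_w ((sample_variance (\row_j X j w) - p) ^+ 2)%:E =
  ((M - p ^+ 2) / N%:R)%:E.
Proof.
have mXn n : measurable_fun [set: R] (fun x => (x ^+ n)%:E).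
  by apply/measurable_EFinP; exact: measurable_funX.
have sqrt_p : (Num.sqrt p ^+ 2)%R = p by rewrite sqr_sqrtr// ltW.
have EX2 j : \int[P]_w (X j w * X j w)%:E = p%:E.
  under eq_integral do rewrite -expr2.
  rewrite (@iid_centered_normal_integral (fun x => (x ^+ 2)%:E))//; last first.
    by move=> x; rewrite lee_fin sqr_ge0.
  by rewrite normal_second_moment ?sqrt_p// sqrtr_gt0.
rewrite -(@integral_mean_deviation_sqr _ _ _ P N (fun j w => X j w * X j w)%R)//.
- apply: eq_integral => w _; rewrite /sample_variance.
  by under eq_bigr do rewrite !mxE.
- by move=> j; exact: measurable_funM.
- by move=> j w; rewrite -expr2 sqr_ge0.
- move=> j; rewrite -M4 -(@iid_centered_normal_integral (fun x => (x ^+ 4)%:E) j)//.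
    by apply: eq_integral => w _; congr (_%:E); ring.
  by move=> x; rewrite lee_fin exprn_even_ge0.
- move=> j k jk; under eq_integral do rewrite EFinM -!expr2.
  rewrite (mutually_independent_integralM (f := fun x => (x ^+ 2)%:E)
    (g := fun x => (x ^+ 2)%:E) iidX.1 jk)//; last 2 first.
  + by move=> x; rewrite lee_fin sqr_ge0.
  + by move=> x; rewrite lee_fin sqr_ge0.
  by under eq_integral do rewrite expr2;
     under [in X in _ * X]eq_integral do rewrite expr2; rewrite !EX2 -EFinM expr2.
Qed.

End sample_variance_deviation.

(** * Limits *)

Section limits.
Context {R : realType}.

Lemma lipschitz_measurable (f : R -> R) (L : R) :
  (forall s t, `|f s - f t| <= L * `|s - t|) -> measurable_fun [set: R] f.
Proof.
move=> hf; apply: continuous_measurable_fun => s.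
apply/cvgrPdist_lt => e e0.
(* Adding 1 keeps the divisor of e positive even when [L] is 0. *)
have L0 : 0 < `|L| + 1 by rewrite ltr_wpDl.
near=> t; rewrite (le_lt_trans (hf _ _))//.
apply: (@le_lt_trans _ _ ((`|L| + 1) * `|s - t|)).
  by rewrite ler_wpM2r// (le_trans (ler_norm _))// lerDl.
rewrite mulrC -ltr_pdivlMr//.
by near: t; apply: cvgr_dist_lt => //; rewrite divr_gt0.
Unshelve. all: by end_near. Qed.

Lemma cvg_cst_divn (C : R) : (fun N : nat => C / N%:R) @ \oo --> 0.
Proof.
rewrite -(mulr0 C); apply: cvgM; first exact: cvg_cst.
(* The shift skips N = 0 and leaves the harmonic sequence. *)
by rewrite -(cvg_shiftS (fun N => N%:R^-1 : R)); exact: cvg_harmonic.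
Qed.

Lemma Lfun2_second_moment d (T : measurableType d) (P : probability T R)
    (X : T -> R) :
  measurable_fun [set: T] X -> ('E_P[X ^+ 2] < +oo)%E -> X \in Lfun P 2%:E.
Proof.
rewrite unlock => mX X2; rewrite inE; apply/andP; split; rewrite inE//=.
rewrite /finite_norm unlock/= poweR_lty//.
rewrite (le_lt_trans _ X2)// le_eqVlt; apply/orP; left; apply/eqP.
apply: eq_integral => w _.
by rewrite powR_mulrn// real_normK ?num_real.
Qed.

(** The bound C / N puts X in L^2, so its mean is finite and its variance nonnegative. Hence E[X]^2
    and the variance both lie between 0 and C / N. *)
Lemma mean_variance_cvg0 (d : nat -> measure_display)
    (T : forall N, measurableType (d N)) (P : forall N, probability (T N) R)
    (X : forall N, T N -> R) (C : R) :
  (\forall N \near \oo, measurable_fun [set: T N] (X N)) ->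
  (\forall N \near \oo, ('E_(P N)[X N ^+ 2] <= (C / N%:R)%:E)%E) ->
  ((fun N => 'E_(P N)[X N]%E) @ \oo --> 0%E) /\
  ((fun N => ('E_(P N)[X N ^+ 2] - 'E_(P N)[X N] ^+ 2)%E) @ \oo --> 0%E).
Proof.
move=> mX X2.
have L2 : \forall N \near \oo, X N \in Lfun (P N) 2%:E.
  near=> N; apply: Lfun2_second_moment; first by near: N.
  rewrite (@le_lt_trans _ _ (C / N%:R)%:E) ?ltry//; by near: N.
have V0 : \forall N \near \oo,
    (0 <= 'E_(P N)[X N ^+ 2] - 'E_(P N)[X N] ^+ 2)%E.
  near=> N; rewrite -varianceE; last by near: N.
  exact: variance_ge0.
have EX : \forall N \near \oo, 'E_(P N)[X N]%E \is a fin_num.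
  near=> N; apply: expectation_fin_num; apply: Lfun_subset12 => //.
    by rewrite fin_num_measure.
  by near: N.
have cC := cvg_cst_divn C.
split.
- have sqE : \forall N \near \oo, fine 'E_(P N)[X N]%E ^+ 2 <= C / N%:R.
    near=> N.
    have EN : 'E_(P N)[X N]%E \is a fin_num by near: N.
    have VN : (0 <= 'E_(P N)[X N ^+ 2] - 'E_(P N)[X N] ^+ 2)%E by near: N.
    have XN : ('E_(P N)[X N ^+ 2] <= (C / N%:R)%:E)%E by near: N.
    rewrite -lee_fin EFin_expe fineK// (le_trans _ XN)//.
    by move: VN; rewrite sube_ge0// fin_numX.
  have -> : 0%E = 0%:E :> \bar R by [].
  apply/fine_cvgP; split => //=.
  apply/cvgr0Pnorm_lt => e e0.
  have e20 : 0 < e ^+ 2 by rewrite exprn_gt0.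
  near=> N.
  rewrite -[ltRHS]gtr0_norm// -ltr_sqr ?nnegrE// !real_normK ?num_real//.
  have h : fine 'E_(P N)[X N]%E ^+ 2 <= C / N%:R by near: N.
  rewrite (le_lt_trans h)//.
  by near: N; apply: (cvgr_lt 0).
- apply: (@squeeze_cvge _ _ _ _ (fun=> 0%E) _ (fun N => (C / N%:R)%:E)).
  + near=> N; apply/andP; split; first by near: N.
    have XN : ('E_(P N)[X N ^+ 2] <= (C / N%:R)%:E)%E by near: N.
    rewrite (le_trans _ XN)// leeBlDr ?fin_numX//; last by near: N.
    by rewrite leeDl ?sqre_ge0.
  + exact: cvg_cst.
  + by apply: cvg_EFin => //; near=> N.
Unshelve. all: by end_near. Qed.

End limits.

(** * Convergence of the discrepancy of the analysis means *)

Theorem mainTheorem3 (R : realType) (m : nat -> R) (r : R) (y : nat -> R)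
    (x0 p0 xt0 pt0 : R)
    (d : nat -> measure_display) (T : forall N : nat, measurableType (d N))
    (P : forall N : nat, probability (T N) R)
    (a : forall N : nat, 'I_N -> {RV (P N) >-> R})
    (m_neq0 : forall i : nat, m i != 0) (r_gt0 : 0 < r)
    (p0_gt0 : 0 < p0) (pt0_gt0 : 0 < pt0)
    (a_law : forall N : nat, (1 < N)%N -> iid_centered_normal (a N) pt0)
    (same_mean : xt0 = x0) (same_variance : pt0 = p0) (i : nat) :
  let Dx (N : nat) (w : T N) : R :=
    analysis_discrepancy m r y x0 p0 xt0 (\row_(j < N) a N j w) i in
  ((fun N : nat => 'E_(P N)[Dx N]%E) @ \oo --> 0%E) /\
  ((fun N : nat => ('E_(P N)[fun w => (Dx N w ^+ 2)%R] - 'E_(P N)[Dx N] ^+ 2)%E)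
     @ \oo --> 0%E).
Proof.
move=> Dx; subst xt0 pt0.
have [L hL] := kf_xa_lipschitz m r_gt0 y x0 i.
have [M hM] := @normal_fourth_moment_fin R (Num.sqrt p0) ltac:(by rewrite sqrtr_gt0).
(* The absolute value extends the map from the half-line to a Lipschitz, hence measurable, function
   on the whole line; sample variances are nonnegative and do not see it. *)
pose g (s : R) := kf_xa m r y x0 `|s| i - kf_xa m r y x0 p0 i.
have mg : measurable_fun [set: R] g.
  apply: (@lipschitz_measurable _ _ `|L|) => s t.
  rewrite /g opprB addrA subrK (le_trans (hL _ _ _ _))//.
  apply: (@le_trans _ _ (`|L| * `| `|s| - `|t| |)).
    by rewrite ler_wpM2r// ler_norm.
  by rewrite ler_wpM2l// ler_dist_dist.
pose S N (w : T N) := sample_variance (\row_(j < N) a N j w).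
have DxE N w : Dx N w = g (S N w).
  by rewrite /Dx /analysis_discrepancy enkf_xaE// /g ger0_norm// sample_variance_ge0.
have mS N : measurable_fun [set: T N] (S N).
  apply: measurable_funM => //; apply: measurable_sum => j.
  under eq_fun do rewrite !mxE.
  exact: measurable_funM.
have mDx N : measurable_fun [set: T N] (Dx N).
  rewrite (_ : Dx N = g \o S N); first exact: measurableT_comp.
  by apply/funext => w /=; rewrite DxE.
(* The squared Lipschitz constant times N E[(S - p0)^2]. *)
apply: (@mean_variance_cvg0 _ _ _ _ _ (L ^+ 2 * (M - p0 ^+ 2))).
  by near=> N.
near=> N.
(* The law of the anomalies is prescribed for N > 1 only, so the bound is an eventual one. *)
have N1 : (1 < N)%N by near: N; exact: nbhs_infty_gt.
rewrite (_ : Dx N ^+ 2 = fun w => Dx N w ^+ 2)// unlock -mulrA EFinM.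
rewrite -(sample_variance_deviation_sqr (ltnW N1) p0_gt0 (a_law N N1) hM).
rewrite -ge0_integralZl_EFin ?sqr_ge0//; first last.
- by apply/measurable_EFinP; apply: measurable_funX; exact: measurable_funB.
- by move=> w _; rewrite lee_fin sqr_ge0.
apply: ge0_le_integral => //.
- by move=> w _; rewrite lee_fin sqr_ge0.
- by apply/measurable_EFinP; exact: measurable_funX.
- apply/measurable_EFinP; apply: measurable_funM => //.
  by apply: measurable_funX; exact: measurable_funB.
- move=> w _; rewrite -EFinM lee_fin -exprMn.
  rewrite -[leLHS]real_normK ?num_real// -[leRHS]real_normK ?num_real//.
  rewrite ler_sqr ?nnegrE//.
  rewrite [Dx N w]DxE /g (ger0_norm (sample_variance_ge0 _)).
  rewrite (le_trans (hL _ _ _ _)) ?sample_variance_ge0 ?(ltW p0_gt0)//.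
  by rewrite normrM ler_wpM2r// ler_norm.
Unshelve. all: by end_near. Qed.
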